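(* Let $G=(S,A,\downarrow,\to)$ be a labeled transition system, $B\subseteq A$, and let $(\mathcal P_1,\sqsubseteq_1)$ and $(\mathcal P_2,\sqsubseteq_2)$ be partition-relation pairs over $G$ that are stable with respect to $\downarrow$, $\to$ and $B$. Then there exists a partition-relation pair $(\mathcal P_3,\sqsubseteq_3)$ over $G$ that is stable with respect to $\downarrow$, $\to$ and $B$, such that $(\mathcal P_1,\sqsubseteq_1)\lhd(\mathcal P_3,\sqsubseteq_3)$ and $(\mathcal P_2,\sqsubseteq_2)\lhd(\mathcal P_3,\sqsubseteq_3)$.
   Context: A labeled transition system $G=(S,A,\downarrow,\to)$ has state set $S$, action set $A$, termination predicate $\downarrow\subseteq S$ (write $p\downarrow$) and transition relation $\to\subseteq S\times A\times S$ (write $p\xrightarrow{a}q$). A partition-relation pair is $(\mathcal P,\sqsubseteq)$ with $\mathcal P$ a partition of $S$ and $\sqsubseteq\subseteq\mathcal P\times\mathcal P$ a partial order. $(\mathcal P,\sqsubseteq)\lhd(\mathcal P',\sqsubseteq')$ iff for all $P,Q\in\mathcal P$ with $P\sqsubseteq Q$ there exist $P',Q'\in\mathcal P'$ with $P\subseteq P'$, $Q\subseteq Q'$, $P'\sqsubseteq'Q'$. For a class $P$ write $P\downarrow$ if all its states terminate and $P\not\downarrow$ if none does. For $P,X\subseteq S$: $P\xrightarrow{a}_\exists X$ means some $p\in P$ has $p\xrightarrow{a}x$ with $x\in X$; $P\xrightarrow{a}_\forall X$ means every $p\in P$ has some $x\in X$ with $p\xrightarrow{a}x$. For $P\in\mathcal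 P$, $\mathrm{lb}(P)=\bigcup\{Q\in\mathcal P\mid Q\sqsubseteq P\}$, $\mathrm{bb}(P)=\bigcup\{Q\in\mathcal P\mid P\sqsubseteq Q\}$. $(\mathcal P,\sqsubseteq)$ is stable (w.r.t. $\downarrow,\to,B$) if: (a) every $P\in\mathcal P$ has $P\downarrow$ or $P\not\downarrow$; (b) if $P\sqsubseteq Q$ and $P\downarrow$ then $Q\downarrow$; (c) for all $P,Q,R\in\mathcal P$, $a\in A$: if $P\sqsubseteq Q$ and $P\xrightarrow{a}_\exists R$ then $Q\xrightarrow{a}_\forall\mathrm{bb}(R)$; (d) for all $P,Q,R\in\mathcal P$, $b\in B$: if $P\sqsubseteq Q$ and $Q\xrightarrow{b}_\exists R$ then $P\xrightarrow{b}_\forall\mathrm{lb}(R)$. *)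

(* Defs.v *)
From mathcomp Require Import all_boot.
From mathcomp Require Import boolp classical_sets.

Set Implicit Arguments.
Unset Strict Implicit.
Unset Printing Implicit Defensive.

Local Open Scope classical_set_scope.

Record lts (S A : Type) := LTS {
  term : set S;
  step : S -> A -> S -> Prop
}.

(* The order [pleq] is a relation on all subsets of S, required by
   [pleq_dom] to be contained in blocks x blocks.  The library predicate
   [partition] includes nonemptiness of the blocks. *)
Record prpair (S : Type) := PRPair {
  blocks : set (set S);
  pleq : set S -> set S -> Prop;
  blocks_partition : partition blocks id [set: S];
  pleq_dom : forall P Q, pleq P Q -> blocks P /\ blocks Q;
  pleq_refl : forall P, blocks P -> pleq P P;
  pleq_anti : forall P Q, pleq P Q -> pleq Q P -> P = Q;
  pleq_trans : forall P Q R, pleq P Q -> pleq Q R -> pleq P R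
}.

Definition prrefines (S : Type) (p p' : prpair S) : Prop :=
  forall P Q, blocks p P -> blocks p Q -> pleq p P Q ->
    exists P' Q', [/\ blocks p' P', blocks p' Q', P `<=` P', Q `<=` Q' &
                      pleq p' P' Q'].

Definition all_term (S A : Type) (G : lts S A) (P : set S) : Prop :=
  forall x, P x -> term G x.

Definition none_term (S A : Type) (G : lts S A) (P : set S) : Prop :=
  forall x, P x -> ~ term G x.

Definition step_ex (S A : Type) (G : lts S A) (P : set S) (a : A)
    (X : set S) : Prop :=
  exists p x, [/\ P p, X x & step G p a x].

Definition step_all (S A : Type) (G : lts S A) (P : set S) (a : A)
    (X : set S) : Prop :=
  forall p, P p -> exists x, X x /\ step G p a x.

Definition lb (S : Type) (p : prpair S) (P : set S) : set S :=
  \bigcup_(Q in [set Q | blocks p Q /\ pleq p Q P]) Q.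

Definition bb (S : Type) (p : prpair S) (P : set S) : set S :=
  \bigcup_(Q in [set Q | blocks p Q /\ pleq p P Q]) Q.

Record stable (S A : Type) (G : lts S A) (B : set A) (p : prpair S) : Prop :=
  Stable {
  stable_term_uniform : forall P, blocks p P -> all_term G P \/ none_term G P;
  stable_term_mono : forall P Q, blocks p P -> blocks p Q ->
    pleq p P Q -> all_term G P -> all_term G Q;
  stable_forth : forall P Q R a, blocks p P -> blocks p Q -> blocks p R ->
    pleq p P Q -> step_ex G P a R -> step_all G Q a (bb p R);
  stable_back : forall P Q R b, blocks p P -> blocks p Q -> blocks p R ->
    B b -> pleq p P Q -> step_ex G Q b R -> step_all G P b (lb p R)
}.

(* Main.v *)
(** A stable pair induces a preorder on states (compare the blocks), and
    stability makes this preorder a partial bisimulation.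
    Conversely, every preorder that is a partial bisimulation yields a stable
    pair: its equivalence classes with the induced order.  Applied to the
    largest partial bisimulation, this gives a pair above every stable pair. *)
Require Import Defs.
From mathcomp Require Import all_boot.
From mathcomp Require Import boolp classical_sets.

Set Implicit Arguments.
Unset Strict Implicit.
Unset Printing Implicit Defensive.

Local Open Scope classical_set_scope.

Section PairStates.
Variables (S : Type) (p : prpair S).

(** By [pleq_dom], [P] and [Q] are blocks, hence the unique blocks containing [x] and [y]. *)
Definition state_le (x y : S) : Prop :=
  exists P Q, [/\ P x, Q y & pleq p P Q].

Lemma block_ex x : exists2 P, blocks p P & P x.
Proof.
have [cov _ _] := blocks_partition p.
have : [set: S] x by [].
by rewrite -cov => -[P bP Px]; exists P.
Qed.

Lemma block_nonempty P : blocks p P -> P !=set0.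
Proof. by have [_ _ ne] := blocks_partition p; exact: ne. Qed.

End PairStates.

Section PreorderPair.
Variables (S : Type) (le : S -> S -> Prop).
Hypothesis le_refl : forall x, le x x.
Hypothesis le_trans : forall x y z, le x y -> le y z -> le x z.

Definition le_class (x : S) : set S := [set y | le x y /\ le y x].
Definition le_classes : set (set S) := range le_class.
Definition class_le (P Q : set S) : Prop :=
  [/\ le_classes P, le_classes Q & exists x y, [/\ P x, Q y & le x y]].

Lemma le_class_refl x : le_class x x.
Proof. by []. Qed.

Lemma le_class_eq x y : le x y -> le y x -> le_class x = le_class y.
Proof.
move=> xy yx; apply/seteqP; split=> z [az za]; split;
  by [exact: le_trans za _ | exact: le_trans _ az].
Qed.

Lemma le_classes_eq P x : le_classes P -> P x -> P = le_class x.
Proof. by move=> [y _ <-] [yx xy]; exact: le_class_eq. Qed.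

Lemma le_classes_le P x y : le_classes P -> P x -> P y -> le x y.
Proof. by move=> cP Px Py; move: Py; rewrite (le_classes_eq cP Px) => -[]. Qed.

(** The order on classes is independent of representatives: the witnesses [x'] and [y'] are
    equivalent to [x] and [y], so the chain [x], [x'], [y'], [y] is increasing. This turns the
    existential in [class_le] into a universal statement. *)
Lemma class_leP P Q x y : class_le P Q -> P x -> Q y -> le x y.
Proof.
move=> [cP cQ [x' [y' [Px' Qy' x'y']]]] Px Qy.
apply: le_trans (le_classes_le cP Px Px') _.
exact: le_trans x'y' (le_classes_le cQ Qy' Qy).
Qed.

Lemma le_class_le x y : le x y -> class_le (le_class x) (le_class y).
Proof. by move=> xy; split; [exists x|exists y|exists x, y]. Qed.

Lemma le_classes_partition : partition le_classes id [set: S].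
Proof.
split.
- apply/seteqP; split=> // x _; exists (le_class x); first by exists x.
  exact: le_class_refl.
- move=> P Q cP cQ [x [Px Qx]].
  by rewrite (le_classes_eq cP Px) (le_classes_eq cQ Qx).
- by move=> _ [x _ <-]; exists x.
Qed.

Lemma class_le_dom P Q : class_le P Q -> le_classes P /\ le_classes Q.
Proof. by case. Qed.

Lemma class_le_refl P : le_classes P -> class_le P P.
Proof. by move=> [x _ <-]; exact: le_class_le. Qed.

Lemma class_le_anti P Q : class_le P Q -> class_le Q P -> P = Q.
Proof.
move=> PQ QP; have [cP cQ [x [y [Px Qy xy]]]] := PQ.
rewrite (le_classes_eq cP Px) (le_classes_eq cQ Qy).
by apply: le_class_eq => //; exact: class_leP QP Qy Px.
Qed.

Lemma class_le_trans P Q R : class_le P Q -> class_le Q R -> class_le P R.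
Proof.
move=> PQ QR; have [cP _ [x [y [Px Qy xy]]]] := PQ.
have [_ cR [_ [z [_ Rz _]]]] := QR.
split=> //; exists x, z; split=> //.
exact: le_trans xy (class_leP QR Qy Rz).
Qed.

Definition preorder_pair : prpair S :=
  PRPair le_classes_partition class_le_dom class_le_refl class_le_anti
    class_le_trans.

(** Since [pleq] is reflexive on blocks, two states of one block are related both ways by
    [state_le p], hence by [le]; so every block lies inside a single class. *)
Lemma prrefines_preorder_pair (p : prpair S) :
  (forall x y, state_le p x y -> le x y) -> prrefines p preorder_pair.
Proof.
move=> ple P Q bP bQ PQ.
have [x Px] := block_nonempty bP; have [y Qy] := block_nonempty bQ.
have sub R z : blocks p R -> R z -> R `<=` le_class z.
  by move=> bR Rz u Ru; split; apply: ple; exists R, R;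
    split=> //; exact: pleq_refl.
exists (le_class x), (le_class y); split; [by exists x|by exists y| | |].
- exact: sub.
- exact: sub.
- by apply: le_class_le; apply: ple; exists P, Q.
Qed.

End PreorderPair.

Section PartialBisimulation.
Variables (S A : Type) (G : lts S A) (B : set A).

(** For empty [B] this is simulation; enlarging [B] moves it towards bisimulation, with termination
    still preserved in one direction only. *)
Record partial_bisim (R : S -> S -> Prop) : Prop := PartialBisim {
  pbisim_term : forall x y, R x y -> term G x -> term G y;
  pbisim_forth : forall x y a x', R x y -> step G x a x' ->
    exists2 y', step G y a y' & R x' y';
  pbisim_back : forall x y b y', R x y -> B b -> step G y b y' ->
    exists2 x', step G x b x' & R x' y'
}.

Definition pbisimilar (x y : S) : Prop :=
  exists2 R, partial_bisim R & R x y.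

Lemma pbisimilar_refl x : pbisimilar x x.
Proof.
exists eq => //; split.
- by move=> y _ <-.
- by move=> y _ a y' <- st; exists y'.
- by move=> y _ b y' <- _ st; exists y'.
Qed.

(** The relational composition of two partial bisimulations is again one: forth steps pass through
    the middle state from left to right, back steps from right to left. *)
Lemma pbisimilar_trans x y z :
  pbisimilar x y -> pbisimilar y z -> pbisimilar x z.
Proof.
move=> [R1 b1 xy] [R2 b2 yz].
exists (fun u w => exists2 v, R1 u v & R2 v w); last by exists y.
split.
- move=> u w [v uv vw] tu; apply: (pbisim_term b2 vw).
  exact: (pbisim_term b1 uv).
- move=> u w a u' [v uv vw] st.
  have [v' vv' u'v'] := pbisim_forth b1 uv st.
  have [w' ww' v'w'] := pbisim_forth b2 vw vv'.
  by exists w' => //; exists v'.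
- move=> u w b w' [v uv vw] Bb st.
  have [v' vv' v'w'] := pbisim_back b2 vw Bb st.
  have [u' uu' u'v'] := pbisim_back b1 uv Bb vv'.
  by exists u' => //; exists v'.
Qed.

(** Each clause concerns one related pair, so the partial bisimulation containing that pair also
    relates the resulting states. Hence the union of all partial bisimulations is the largest
    one. *)
Lemma partial_bisim_pbisimilar : partial_bisim pbisimilar.
Proof.
split.
- by move=> x y [R bR xy]; exact: (pbisim_term bR xy).
- move=> x y a x' [R bR xy] st.
  by have [y' yy' x'y'] := pbisim_forth bR xy st; exists y' => //; exists R.
- move=> x y b y' [R bR xy] Bb st.
  by have [x' xx' x'y'] := pbisim_back bR xy Bb st; exists x' => //; exists R.
Qed.

Lemma stable_partial_bisim (p : prpair S) :
  stable G B p -> partial_bisim (state_le p).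
Proof.
move=> st; split.
- move=> x y [P [Q [Px Qy PQ]]] tx; have [bP bQ] := pleq_dom PQ.
  apply: (stable_term_mono st bP bQ PQ) => //.
  (* Uniformity lifts termination of the single state [x] to its whole block [P]. *)
  by case: (stable_term_uniform st bP) => // /(_ x Px).
- move=> x y a x' [P [Q [Px Qy PQ]]] xx'; have [bP bQ] := pleq_dom PQ.
  have [R bR Rx'] := block_ex p x'.
  have PaR : step_ex G P a R by exists x, x'.
  have [y' [[T [_ RT] Ty'] yy']] := stable_forth st bP bQ bR PQ PaR Qy.
  by exists y' => //; exists R, T.
- move=> x y b y' [P [Q [Px Qy PQ]]] Bb yy'; have [bP bQ] := pleq_dom PQ.
  have [R bR Ry'] := block_ex p y'.
  have QbR : step_ex G Q b R by exists y, y'.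
  have [x' [[T [_ TR] Tx'] xx']] := stable_back st bP bQ bR Bb PQ QbR Px.
  by exists x' => //; exists T, R.
Qed.

(** By [class_leP], a step from one state of a class is matched from every state of a related class,
    which gives the passage from [step_ex] to [step_all]. *)
Lemma stable_preorder_pair (le : S -> S -> Prop)
    (le_refl : forall x, le x x)
    (le_trans : forall x y z, le x y -> le y z -> le x z) :
  partial_bisim le -> stable G B (preorder_pair le_refl le_trans).
Proof.
move=> ble; split=> /=.
- move=> P cP; have [[x [Px tx]]|nt] := pselect (exists x, P x /\ term G x).
    left=> y Py; apply: (pbisim_term ble) tx.
    exact: (le_classes_le le_trans cP Px Py).
  by right=> x Px tx; apply: nt; exists x.
(* The witness in [class_le] supplies an actual terminating state of [P], so [all_term G P] is not
   vacuous. *)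
- move=> P Q _ _ PQ tP y Qy; have [_ _ [x [_ [Px _ _]]]] := PQ.
  exact: (pbisim_term ble) (class_leP le_trans PQ Px Qy) (tP x Px).
- move=> P Q R a _ _ cR PQ [x [x' [Px Rx' xx']]] y Qy.
  have [y' yy' x'y'] :=
    pbisim_forth ble (class_leP le_trans PQ Px Qy) xx'.
  (* The class of [y'] lies above [R], which is the class of [x']. *)
  exists y'; split=> //; exists (le_class le y'); last exact: le_class_refl.
  split; first by exists y'.
  by rewrite (le_classes_eq le_trans cR Rx'); exact: le_class_le.
- move=> P Q R b _ _ cR Bb PQ [y [y' [Qy Ry' yy']]] x Px.
  have [x' xx' x'y'] :=
    pbisim_back ble (class_leP le_trans PQ Px Qy) Bb yy'.
  exists x'; split=> //; exists (le_class le x'); last exact: le_class_refl.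
  split; first by exists x'.
  by rewrite (le_classes_eq le_trans cR Ry'); exact: le_class_le.
Qed.

End PartialBisimulation.

Theorem theorem5 (S A : Type) (G : lts S A) (B : set A) (p1 p2 : prpair S)
    (stable1 : stable G B p1) (stable2 : stable G B p2) :
  exists p3 : prpair S,
    [/\ stable G B p3, prrefines p1 p3 & prrefines p2 p3].
Proof.
(* This pair depends only on [G] and [B], so the same argument serves [p1] and [p2]. *)
exists (preorder_pair (@pbisimilar_refl S A G B) (@pbisimilar_trans S A G B)).
split.
- exact/stable_preorder_pair/partial_bisim_pbisimilar.
- apply: prrefines_preorder_pair => x y xy.
  by exists (state_le p1) => //; exact: stable_partial_bisim.
- apply: prrefines_preorder_pair => x y xy.
  by exists (state_le p2) => //; exact: stable_partial_bisim.
Qed.
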